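(* For every integer $n \geq 1$ there is a set $A \subset [n]$ that is a $C_3[3]$-set in $\mathbb{Z}$ and satisfies $$|A| \geq \left(4^{-2/3} + o(1)\right) n^{2/3},$$ where $o(1)$ denotes a quantity tending to $0$ as $n \to \infty$.
   Context: $[n] = \{1,2,\dots,n\}$. Let $\Gamma$ be an abelian group and $g \geq h \geq 2$ integers. A set $A \subset \Gamma$ is a $C_h[g]$-set if, for any set $X \subset \Gamma$ with $|X| = h$ and any set $\{k_1,\dots,k_g\} \subset \Gamma$ of $g$ distinct elements, at least one of the translates $X + k_i := \{x + k_i : x \in X\}$ is not contained in $A$. Here $g=h=3$ and $\Gamma = \mathbb{Z}$. *)

(* Defs.v *)
From HB Require Import structures.
From mathcomp Require Import all_boot all_order all_algebra finmap.
From mathcomp Require Import all_classical all_reals all_analysis.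

Set Implicit Arguments.
Unset Strict Implicit.
Unset Printing Implicit Defensive.

Import Order.TTheory GRing.Theory Num.Theory.
Import numFieldNormedType.Exports.

Local Open Scope classical_set_scope.
Local Open Scope ring_scope.

Definition translate (G : zmodType) (X : set G) (k : G) : set G :=
  [set x + k | x in X].

(* Meant for 2 <= h <= g; K is the set {k_1, ..., k_g} of g distinct
   elements. *)
Definition is_C_set (G : zmodType) (h g : nat) (A : set G) : Prop :=
  forall X K : {fset G}, #|` X| = h -> #|` K| = g ->
    exists2 k, k \in K & ~ (translate [set` X] k `<=` A).

Definition initial_segment (n : nat) : set int :=
  [set x : int | 1 <= x <= n%:Z].

(* Main.v *)
Require Import Defs.
From HB Require Import structures.
From mathcomp Require Import all_boot all_order all_algebra finmap.
From mathcomp Require Import all_classical all_reals all_analysis.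
From mathcomp Require Import all_solvable all_field ring zify.

Set Implicit Arguments.
Unset Strict Implicit.
Unset Printing Implicit Defensive.

Import Order.TTheory GRing.Theory Num.Theory.
Import numFieldNormedType.Exports.

Local Open Scope classical_set_scope.
Local Open Scope ring_scope.

(* Primes are not needed.  Let q = 2^k, let K be the field with q^4 elements,
   tr z = z + z^(q^2), and T = {z | tr(z)^(q+1) = 1}.  T is a union of cosets of
   the group of (q+1)-th roots of unity, has q^2 (q+1) elements, and its image
   in the cyclic quotient, of order (q-1)(q^2+1), is a C_3[3]-set: with
   r = x / x^(q^2) and s = k^(q^2) / k, tr(x k) is x^(q^2) k (r + s), so that
   three x and three k with all x k in T give (r_i + s_j)^(q+1) = c_i e_j, which
   is impossible as in the projective norm graphs.  Hence, for a generator g,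
   the exponents l with y g^l in T form a C_3[3]-set in any window of length
   at most (q-1)(q^2+1), of density more than 1/q for a suitable y.  Choosing
   n/4 <= q^3 <= 16 n makes this set large enough for every n, with error term
   zero: the density slack absorbs the gaps between powers of 2. *)

(** * Excluding [K_{3,3}] in norm graphs *)

Lemma quadratic_three_roots (K : fieldType) (a b c : K) (z : 'I_3 -> K) :
    injective z -> (forall i, a * z i ^+ 2 + b * z i + c = 0) ->
  a = 0.
Proof.
move=> z_inj z_root.
have zN (i j : 'I_3) : i != j -> z i - z j != 0.
  by move=> ij; rewrite subr_eq0 (inj_eq z_inj).
pose i1 : 'I_3 := lift ord0 ord0.
have slope j : j != ord0 -> a * (z ord0 + z j) + b = 0.
  move=> j0; apply: (mulfI (zN _ _ j0)); rewrite mulr0.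
  by rewrite -(subrr 0) -{1}(z_root j) -(z_root ord0); ring.
apply: (mulIf (zN i1 ord_max isT)); rewrite mul0r.
by rewrite -(subrr 0) -{1}(slope i1 isT) -(slope ord_max isT); ring.
Qed.

(** Dividing by the equation for [ord_max] cancels [e j]. After the inversions [u] and [z], the
    other two indices give norm circles [(u i + z j) ^+ q.+1 = al i] with distinct centers and three
    common points [z j]; raising to the power [q] is additive here. *)
Lemma norm_no_K33 (K : fieldType) (q : nat) (r s c e : 'I_3 -> K) :
    [pchar K].-nat q ->
    injective r -> injective s ->
    (forall i, c i != 0) -> (forall j, e j != 0) ->
  ~ (forall i j, (r i + s j) ^+ q.+1 = c i * e j).
Proof.
move=> qK r_inj s_inj c0 e0 rsE.
have rs0 i j : r i + s j != 0.
  apply: contra_eq_neq (rsE i j) => ->.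
  by rewrite exprS mul0r eq_sym mulf_neq0.
pose z j := (r ord_max + s j)^-1.
have z_inj : injective z by move=> j j' /invr_inj /addrI /s_inj.
pose u i := (r i - r ord_max)^-1.
have u0 i : i != ord_max -> u i != 0.
  by move=> im; rewrite invr_eq0 subr_eq0 (inj_eq r_inj).
pose al i := c i / c ord_max * u i ^+ q.+1.
have circle i j : i != ord_max ->
    (u i + z j) * (u i ^+ q + z j ^+ q) = al i.
  move=> im; rewrite -exprDn_pchar // -exprS.
  have -> : u i + z j = (r i + s j) * (u i * z j).
    have := u0 i im; rewrite invr_eq0 /u /z => d0.
    by field; rewrite rs0.
  rewrite !exprMn rsE /al [z j ^+ _]exprVn rsE.
  by field; rewrite c0 e0.
pose i1 : 'I_3 := lift ord0 ord0.
set u1 := u ord0; set u2 := u i1.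
have u12 : u1 - u2 != 0.
  rewrite subr_eq0; apply/negP => /eqP /invr_inj /addIr /r_inj.
  by move/(congr1 val).
(* Subtracting the two circles makes the conjugate [z j ^+ q] affine in
   [z j], so that either circle becomes a quadratic equation. *)
pose A := - (u1 ^+ q - u2 ^+ q) / (u1 - u2).
pose B := (al ord0 - al i1 - u1 * u1 ^+ q + u2 * u2 ^+ q) / (u1 - u2).
have zq j : z j ^+ q = A * z j + B.
  apply: (mulfI u12).
  rewrite /A /B -(circle ord0 j isT) -(circle i1 j isT) -/u1 -/u2.
  by field.
have A0 : A = 0.
  apply: (@quadratic_three_roots K A (A * u1 + u1 ^+ q + B)
           (u1 * (u1 ^+ q + B) - al ord0) z z_inj) => j.
  by rewrite -(circle ord0 j isT) zq -/u1; ring.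
(* By additivity, the numerator of [A] is [- (u1 - u2) ^+ q], which is nonzero. *)
move/eqP: A0; rewrite mulf_eq0 invr_eq0 (negPf u12) orbF oppr_eq0.
by rewrite -exprNn_pchar // -exprDn_pchar // expf_eq0 (negPf u12) andbF.
Qed.

Lemma trace_no_K33 (K : fieldType) (q : nat) (x k : 'I_3 -> K) :
    [pchar K].-nat q ->
    (forall i i', (x i / x i') ^+ q.+1 = 1 -> i = i') ->
    (forall j j', (k j / k j') ^+ q.+1 = 1 -> j = j') ->
  ~ (forall i j, (x i * k j + (x i * k j) ^+ (q ^ 2)) ^+ q.+1 = 1).
Proof.
move=> qK x_inj k_inj trE.
have q20 : (0 : K) ^+ (q ^ 2) = 0.
  by rewrite expr0n eqn0Ngt expn_gt0 (andP qK).1.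
have xk0 i j : x i * k j != 0.
  apply: contra_eq_neq (trE i j) => ->.
  by rewrite q20 addr0 exprS mul0r eq_sym oner_eq0.
have x0 i : x i != 0.
  by apply: contraNneq (xk0 i ord0) => ->; rewrite mul0r.
have k0 j : k j != 0.
  by apply: contraNneq (xk0 ord0 j) => ->; rewrite mulr0.
have trM (w v : K) : w ^+ (q ^ 2) = w ->
    w * v + (w * v) ^+ (q ^ 2) = w * (v + v ^+ (q ^ 2)).
  by move=> wE; rewrite exprMn wE mulrDr.
pose r i := x i / x i ^+ (q ^ 2).
pose s j := k j ^+ (q ^ 2) / k j.
(* If [r i = r i'], then [x i / x i'] is fixed by the power [q ^ 2], so it factors out of the trace.
   Comparing two instances of [trE] makes it a [q.+1]-th root of unity, which [x_inj] forbids. The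
   same argument serves for [s]. *)
have r_inj : injective r.
  move=> i i' ri; apply: x_inj.
  have wE : (x i / x i') ^+ (q ^ 2) = x i / x i'.
    rewrite exprMn exprVn; apply: (mulfI (mulf_neq0 (x0 i') (invr_neq0
      (expf_neq0 (q ^ 2) (x0 i))))).
    rewrite [RHS](_ : _ = r i); last first.
      by rewrite /r; field; rewrite expf_neq0 ?x0.
    by rewrite ri /r; field; rewrite !expf_neq0 ?x0.
  have := trE i ord0.
  rewrite (_ : x i * _ = x i / x i' * (x i' * k ord0)); last by field.
  by rewrite trM // exprMn trE mulr1.
have s_inj : injective s.
  move=> j j' sj; apply: k_inj.
  have wE : (k j / k j') ^+ (q ^ 2) = k j / k j'.
    rewrite exprMn exprVn; apply: (mulfI (mulf_neq0 (invr_neq0 (k0 j))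
      (expf_neq0 (q ^ 2) (k0 j')))).
    rewrite [RHS](_ : _ = s j'); last by rewrite /s; field; rewrite !k0.
    by rewrite -sj /s; field; rewrite !expf_neq0 ?k0.
  have := trE ord0 j.
  rewrite (_ : x ord0 * _ = k j / k j' * (x ord0 * k j')); last by field.
  by rewrite trM // exprMn trE mulr1.
apply: (@norm_no_K33 K q r s (fun i => (x i ^+ (q ^ 2)) ^- q.+1)
         (fun j => k j ^- q.+1)) => //.
- by move=> i; rewrite invr_neq0 // !expf_neq0.
- by move=> j; rewrite invr_neq0 // expf_neq0.
move=> i j.
have -> : r i + s j = (x i * k j + (x i * k j) ^+ (q ^ 2))
    * ((x i ^+ (q ^ 2))^-1 / k j).
  by rewrite exprMn /r /s; field; rewrite expf_neq0 ?x0 ?k0.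
by rewrite [LHS]exprMn trE mul1r exprMn !exprVn.
Qed.

(** * Counting the elements whose trace has norm 1 *)

Lemma card_root_lt (K : finFieldType) (p : {poly K}) :
  p != 0 -> (#|[pred x | root p x]| < size p)%N.
Proof.
move=> p0; rewrite cardE max_poly_roots ?enum_uniq //.
by apply/allP => x; rewrite mem_enum.
Qed.

(* The values of [tr x ^+ q.+1] satisfy [c ^+ q = c], and the degree bounds on
   the fibers over 0 and over the other such [c] add up to exactly [q ^ 4], so
   that all these bounds are attained. *)
Lemma norm_trace_fiber (K : finFieldType) (q : nat) :
    [pchar K].-nat q -> #|K| = (q ^ 4)%N -> (1 < q)%N ->
  (q ^ 2 * q.+1 <= #|[pred x : K | (x + x ^+ (q ^ 2)) ^+ q.+1 == 1%R]|)%N.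
Proof.
move=> qK cardK q1.
pose tr (x : K) := x + x ^+ (q ^ 2).
pose fib c := [pred x : K | tr x ^+ q.+1 == c].
pose P : {poly K} := 'X^(q ^ 2) + 'X.
have Q1 : (1 < q ^ 2)%N by rewrite -(exp1n 2) ltn_exp2r.
have sizeP : size P = (q ^ 2).+1.
  by rewrite size_polyDl size_polyXn ?size_polyX.
have P0 : P != 0 by rewrite -size_poly_eq0 sizeP.
have PE x : P.[x] = tr x by rewrite !hornerE addrC.
have fib0 : (#|fib 0%R| <= q ^ 2)%N.
  rewrite -ltnS -sizeP; apply: leq_trans (card_root_lt P0).
  rewrite ltnS subset_leq_card //; apply/fintype.subsetP => x.
  by rewrite !inE expf_eq0 /= rootE PE.
have fib_le c : (#|fib c| <= q ^ 2 * q.+1)%N.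
  have sizePq : size (P ^+ q.+1) = (q ^ 2 * q.+1).+1.
    by rewrite -[LHS]prednK ?size_exp ?sizeP // size_poly_gt0 expf_neq0.
  have sizePc : size (P ^+ q.+1 - c%:P) = (q ^ 2 * q.+1).+1.
    rewrite size_polyDl ?sizePq // size_polyN.
    rewrite (leq_ltn_trans (size_polyC_leq1 _)) //.
    by rewrite ltnS muln_gt0 expn_gt0 (ltnW q1).
  rewrite -ltnS -sizePc.
  have Pc0 : P ^+ q.+1 - c%:P != 0 by rewrite -size_poly_eq0 sizePc.
  apply: leq_trans (card_root_lt Pc0).
  rewrite ltnS subset_leq_card //; apply/fintype.subsetP => x.
  by rewrite !inE rootE hornerD hornerN hornerC horner_exp PE subr_eq0.
pose S := [pred c : K | c ^+ q == c].
have cardS : (#|S| <= q)%N.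
  have sizeX : size ('X^q - 'X : {poly K}) = q.+1.
    by rewrite size_polyDl size_polyXn // size_polyN size_polyX.
  have X0 : 'X^q - 'X != 0 :> {poly K} by rewrite -size_poly_eq0 sizeX.
  rewrite -ltnS -sizeX; apply: leq_trans (card_root_lt X0).
  rewrite ltnS subset_leq_card //; apply/fintype.subsetP => x.
  by rewrite !inE rootE !hornerE subr_eq0.
(* Since [x ^+ (q ^ 4) = x], the power [q ^ 2] swaps the two terms of the trace. *)
have trQ x : tr x ^+ (q ^ 2) = tr x.
  rewrite /tr exprDn_pchar; last by rewrite pnatX qK.
  by rewrite -exprM -expnD -cardK expf_card addrC.
have fS x : S (tr x ^+ q.+1).
  by rewrite /= -exprM mulSn exprD mulnn trQ -exprSr.
have S0 : 0 \in S by rewrite inE expr0n eqn0Ngt (ltnW q1).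
have S1 : 1 \in [predD1 S & 0] by rewrite !inE expr1n eqxx oner_eq0.
have sum_fib : (\sum_(c in S) #|fib c|)%N = (q ^ 4)%N.
  rewrite -cardK -sum1_card [RHS](partition_big (fun x => tr x ^+ q.+1) S) /=.
    by apply: eq_big => // c _; rewrite -sum1_card; apply: eq_bigl.
  by move=> x _; apply: fS.
rewrite (bigD1 0) //= (bigD1 1) /= in sum_fib; last first.
  by rewrite -topredE /= expr1n eqxx oner_eq0.
set rest := (\sum_(i | _) _)%N in sum_fib.
have rest_le : (rest <= (q - 2) * (q ^ 2 * q.+1))%N.
  have /leq_trans : (rest <=
      \sum_(c in [pred c | (c \in S) && (c != 0%R) && (c != 1%R)])
        q ^ 2 * q.+1)%N by apply: leq_sum => c _; apply: fib_le.
  apply.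
  rewrite sum_nat_const leq_mul2r; apply/orP; right.
  rewrite (cardD1 0) S0 (cardD1 1) S1 in cardS.
  rewrite leq_subRL // add2n; apply: leq_trans cardS.
  by rewrite !add1n !ltnS subset_leq_card //; apply/fintype.subsetP => x;
    rewrite !inE andbC => /and3P[-> -> ->].
change (q ^ 2 * q.+1 <= #|fib 1%R|)%N.
have qE : (q ^ 4 = q ^ 2 + (q - 2) * (q ^ 2 * q.+1) + q ^ 2 * q.+1)%N.
  case: (q) q1 => [|[|m]] // _; rewrite !subSS subn0 !expnS expn0; nia.
have cardE : (#|fib 0%R| + (#|fib 1%R| + rest) = q ^ 4)%N := sum_fib.
by lia.
Qed.

(** * From the field to windows of integer exponents *)

Lemma exists_primitive_root (K : finFieldType) :
  exists g : K, #|K|.-1.-primitive_root g.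
Proof.
have K1 := finRing_gt1 K.
pose rs := enum [pred x : K | x != 0].
have /hasP[g _ gP] : has #|K|.-1.-primitive_root rs; last by exists g.
have sizers : size rs = #|K|.-1.
  by rewrite -cardE -(cardC1 (0 : K)); apply: eq_card.
apply: has_prim_root; rewrite ?enum_uniq ?sizers //.
  by rewrite -ltnS prednK // ltnW.
apply/allP => x; rewrite mem_enum inE => x0.
rewrite unity_rootE; apply/eqP/(mulfI x0).
by rewrite mulr1 -exprS prednK ?expf_card // ltnW.
Qed.

(** Averaging over [y]: as [h i != 0], multiplication by [h i] is a bijection, so each [i] is
    counted [#|T|] times in total, and some [y] reaches the mean. *)
Lemma exists_dense_dilate (K : finFieldType) (T : pred K) (w : nat)
    (h : 'I_w -> K) :
    (forall i, h i != 0) ->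
  exists y, (w * #|T| <= #|K| * #|[pred i | T (y * h i)%R]|)%N.
Proof.
move=> h0; apply: contrapT => nex.
have lt y : (#|K| * #|[pred i | T (y * h i)%R]| < w * #|T|)%N.
  by rewrite ltnNge; apply/negP => le; apply: nex; exists y.
have K0 : (0 < #|K|)%N by apply/card_gt0P; exists 0.
have dbl : (\sum_y #|[pred i | T (y * h i)%R]| = w * #|T|)%N.
  under eq_bigr do rewrite -sum1_card big_mkcond.
  rewrite exchange_big /= -[in RHS](card_ord w) -sum_nat_const.
  apply: eq_bigr => i _; rewrite -big_mkcond sum1_card.
  rewrite -(card_imset _ (mulIf (h0 i))) -[RHS]cardsE; apply: eq_card => x.
  rewrite !inE; apply/imsetP/idP => [[y Ty ->] //|Tx].
  by exists (x / h i); rewrite -?topredE /= divfK ?h0.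
have : (\sum_(y : K) #|K| * #|[pred i | T (y * h i)%R]|
    < \sum_(y : K) w * #|T|)%N.
  rewrite (bigD1 0) //= [X in (_ < X)%N](bigD1 0) //= -addSn leq_add //.
  by apply: leq_sum => y _; apply: ltnW.
by rewrite -big_distrr /= dbl sum_nat_const ltnn.
Qed.

Lemma prim_root_expz_eq1 (F : fieldType) (n : nat) (g : F) (z : int) :
  n.-primitive_root g -> g ^ z = 1 -> (n %| `|z|)%N.
Proof.
move=> gP; rewrite (prim_order_dvd gP); case: z => m gm; apply/eqP.
  exact: gm.
by apply: invr_inj; rewrite invr1; apply: gm.
Qed.

Lemma fset3_enum (T : choiceType) (X : {fset T}) :
  #|` X| = 3%N -> exists2 x : 'I_3 -> T, injective x & forall i, x i \in X.
Proof.
move=> X3.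
have /fset0Pn[x0 _] : X != fset0 by rewrite -cardfs_gt0 X3.
exists (fun i : 'I_3 => nth x0 X i) => [i j /eqP|i].
  by rewrite nth_uniq ?X3 // => /eqP/val_inj.
by rewrite mem_nth // X3.
Qed.

(** The bound on [w] is [(q ^ 4 - 1) / (q + 1)], the order of the quotient by the [q.+1]-th roots of
    unity, so exponents in the window have distinct classes. The density is that of the norm-trace
    fiber, at least [q ^ 2 * q.+1] out of [q ^ 4]. *)
Lemma C33_window (q w : nat) (K : finFieldType) :
    [pchar K].-nat q -> #|K| = (q ^ 4)%N -> (1 < q)%N ->
    (w <= (q - 1) * (q ^ 2).+1)%N ->
  exists A : {fset int}, [/\ [set` A] `<=` initial_segment w,
    is_C_set 3 3 [set` A] & (w * q.+1 <= q ^ 2 * #|` A|)%N].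
Proof.
move=> qK cardK q1 w_le.
have [g gP] := exists_primitive_root K.
have g0 : g != 0.
  apply: contra_eq_neq (prim_expr_order gP) => ->.
  by rewrite expr0n eqn0Ngt (prim_order_gt0 gP) eq_sym oner_eq0.
pose T : pred K := [pred x | (x + x ^+ (q ^ 2)) ^+ q.+1 == 1].
have [y yT] := @exists_dense_dilate K T w (fun i => g ^+ i.+1)
  (fun i => expf_neq0 _ g0).
pose A := [fset (Posz i.+1) |
  i : 'I_w in [pred i : 'I_w | T (y * g ^+ i.+1)]]%fset.
have memA a : a \in A -> 1 <= a <= w%:Z /\ T (y * g ^ a).
  by move=> /imfsetP[i /= Ti ->]; split=> //; rewrite lez_nat ltn_ord.
exists A; split.
- by move=> a /= /memA[].
- move=> X L /fset3_enum[x x_inj xX] /fset3_enum[k k_inj kL].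
  apply: contrapT => nex.
  have xkA i j : x i + k j \in A.
    apply: contrapT => xkN; apply: nex; exists (k j) => // sub.
    by apply: xkN; apply: (sub (x i + k j)); exists (x i) => //=; apply: xX.
  have xk_ge1 i j : 1 <= x i + k j by have [/andP[]] := memA _ (xkA i j).
  have xk_lew i j : x i + k j <= w%:Z by have [/andP[]] := memA _ (xkA i j).
  have small (z : int) : `|z| < w%:Z -> (g ^ z) ^+ q.+1 = 1 -> z = 0.
    move=> zw; rewrite exprnP exprz_exp => /(prim_root_expz_eq1 gP).
    rewrite cardK => dvd; apply: contrapT => /eqP z0.
    have z0' : (0 < `|z|)%N by rewrite lt0n absz_eq0.
    have := dvdn_leq _ dvd; rewrite abszM muln_gt0 z0' /= => /(_ isT).
    have zM : (`|z| < (q - 1) * (q ^ 2).+1)%N by lia.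
    have qE : ((q ^ 4).-1 = (q - 1) * (q ^ 2).+1 * q.+1)%N.
      by case: (q) q1 => [|m] // _; rewrite subn1 /= !expnS expn0; nia.
    by rewrite qE leqNgt ltn_pmul2r // zM.
  (* Zero has trace 0, so it lies outside [T], while [A] has an element. *)
  have y0 : y != 0.
    have [_] := memA _ (xkA ord0 ord0).
    apply: contraTneq => ->; rewrite mul0r /T /= add0r -exprM expr0n.
    by rewrite muln_eq0 expn_eq0 -!leqn0 leqNgt (ltnW q1) eq_sym oner_eq0.
  apply: (@trace_no_K33 K q (fun i => y * g ^ x i) (fun j => g ^ k j)) => //.
  (* The difference [x i - x i'] is also one of two members of [A], after adding [k ord0] to both,
     hence smaller than [w] in absolute value. *)
  + move=> i i' e; apply: x_inj; apply/eqP; rewrite -subr_eq0; apply/eqP/small.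
      move: (xk_ge1 i ord0) (xk_lew i ord0).
      by move: (xk_ge1 i' ord0) (xk_lew i' ord0); lia.
    rewrite -e expfzDr // -invr_expz; congr (_ ^+ _).
    by field; rewrite expfz_neq0.
  + move=> i i' e; apply: k_inj; apply/eqP; rewrite -subr_eq0; apply/eqP/small.
      move: (xk_ge1 ord0 i) (xk_lew ord0 i).
      by move: (xk_ge1 ord0 i') (xk_lew ord0 i'); lia.
    by rewrite -e expfzDr // -invr_expz.
  + move=> i j; rewrite -mulrA -expfzDr //; apply/eqP.
    by have [] := memA _ (xkA i j).
have cardA : #|` A| = #|[pred i : 'I_w | T (y * g ^+ i.+1)]|.
  rewrite card_imfset /= ?cardE //.
  by move=> i j [] /val_inj.
rewrite cardA.
have T_ge := norm_trace_fiber qK cardK q1.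
have Q0 : (0 < q ^ 2)%N by rewrite expn_gt0 (ltnW q1).
rewrite -(leq_pmul2l Q0) [leqRHS]mulnA -expnD mulnCA -cardK.
by apply: leq_trans yT; rewrite leq_mul2l T_ge orbT.
Qed.

(** * Reaching every [n] with powers of 2 *)

Lemma powR_le_of_sqr_le (R : realType) (n a : nat) :
  (n ^ 2 <= 16 * a ^ 3)%N -> (4 `^ (- (2 / 3))) * n%:R `^ (2 / 3) <= a%:R :> R.
Proof.
move=> na.
(* Everything is written as a cube root, with [16 = 4 ^ 2], so that monotonicity reduces the claim
   to the integer inequality. *)
have -> : a%:R = (a%:R ^+ 3) `^ (3^-1) :> R.
  by rewrite -powR_mulrn // -powRrM mulfV ?powRr1 // pnatr_eq0.
have -> : n%:R `^ (2 / 3) = (n%:R ^+ 2) `^ 3^-1 :> R.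
  by rewrite -powR_mulrn // -powRrM.
have -> : 4 `^ (- (2 / 3)) = (16^-1) `^ 3^-1 :> R.
  have -> : 16^-1 = 4 `^ (- 2) :> R by rewrite powRN powR_mulrn //; field.
  by rewrite -powRrM mulNr.
rewrite -powRM ?invr_ge0 ?exprn_ge0 //.
rewrite ge0_ler_powR ?nnegrE ?mulr_ge0 ?exprn_ge0 ?invr_ge0 //.
by rewrite mulrC ler_pdivrMr // mulrC -!natrX -natrM ler_nat.
Qed.

(** Here [8 ^ k] is the cube of [q = 2 ^ k]. In the induction [k] is kept until [n] exceeds
    [4 * 8 ^ k], and then raised by one; [0 < k] ensures [1 < q]. *)
Lemma exists_exp8 (n : nat) : (0 < n)%N ->
  exists2 k : nat, (0 < k)%N & (n <= 4 * 8 ^ k)%N && (8 ^ k <= 16 * n)%N.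
Proof.
elim: n => // -[_ _|n IHn _]; first by exists 1%N.
have [k k0 /andP[nk kn]] := IHn isT.
have [le|lt] := leqP n.+2 (4 * 8 ^ k); first by exists k; rewrite // le /=; lia.
by exists k.+1 => //; rewrite expnS; lia.
Qed.

(** If the window is [n], then [n <= q * a], and cubing with [q ^ 3 <= 16 * n] suffices. Otherwise
    the hypothesis reads [q ^ 4 - 1 <= q ^ 2 * a], which by integrality forces [q ^ 2 <= a], and
    [n <= 4 * q ^ 3] concludes. *)
Lemma sqr_le_of_window (q n a : nat) :
    (1 < q)%N -> (0 < n)%N -> (n <= 4 * q ^ 3)%N -> (q ^ 3 <= 16 * n)%N ->
    (minn n ((q - 1) * (q ^ 2).+1) * q.+1 <= q ^ 2 * a)%N ->
  (n ^ 2 <= 16 * a ^ 3)%N.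
Proof.
move=> q1 n0 nq qn; have q0 := ltnW q1.
rewrite /minn; case: ifP => _ wa.
  have na : (n <= q * a)%N.
    rewrite -(leq_pmul2r q0) mulnAC mulnn; apply: leq_trans wa.
    by rewrite leq_mul2l leqnSn orbT.
  rewrite -(leq_pmul2l n0) -expnS mulnCA mulnA.
  have: (n ^ 3 <= q ^ 3 * a ^ 3)%N by rewrite -expnMn leq_exp2r.
  by move=> /leq_trans; apply; rewrite leq_mul2r qn orbT.
have qa : (q ^ 2 <= a)%N.
  rewrite leqNgt; apply/negP => aq.
  have : (q ^ 2 * a.+1 <= q ^ 2 * q ^ 2)%N by rewrite leq_mul2l aq orbT.
  move: wa; case: (q) q1 => [|[|m]] // _.
  by rewrite subn1 /= !expnS expn0; nia.
have: (n ^ 2 <= (4 * q ^ 3) ^ 2)%N by rewrite leq_exp2r.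
move=> /leq_trans; apply; rewrite expnMn leq_mul2l -expnM (expnM q 2 3).
by rewrite leq_exp2r // qa.
Qed.

Theorem corollary1 (R : realType) :
  exists eps : nat -> R,
    eps n @[n --> \oo] --> (0 : R) /\
    forall n : nat, (1 <= n)%N ->
      exists A : {fset int},
        [/\ [set` A] `<=` initial_segment n,
            is_C_set 3 3 [set` A] &
            (4 `^ (- (2 / 3)) + eps n) * n%:R `^ (2 / 3) <= #|` A|%:R].
Proof.
exists (fun=> 0); split; first exact: cvg_cst.
move=> n n0; have [k k0 /andP[nk kn]] := exists_exp8 n0.
have k4 : (0 < k * 4)%N by rewrite muln_gt0 k0.
have [K K2 cardK] := @pPrimePowerField 2 _ isT k4.
rewrite expnM in cardK; set q := (2 ^ k)%N in cardK.
have q1 : (1 < q)%N by rewrite -(exp1n k) ltn_exp2r.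
have q3 : (8 ^ k = q ^ 3)%N by rewrite -expnM mulnC expnM.
have qK : [pchar K].-nat q by rewrite pnatX pnatE ?K2.
pose M := ((q - 1) * (q ^ 2).+1)%N.
have [A [AI AC Acard]] := C33_window qK cardK q1 (geq_minr n M).
exists A; split => //.
  move=> a /AI /andP[a1 /le_trans aw]; rewrite /initial_segment /= a1 aw //.
  by rewrite lez_nat geq_minl.
rewrite addr0; apply: powR_le_of_sqr_le.
by apply: (sqr_le_of_window q1 n0 _ _ Acard); rewrite -q3.
Qed.
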